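(* Let $x>0$ be given and let $\boldsymbol\kappa=(\kappa_n)_{n\geqslant 1}$ be any fixed sequence of integers with $\lim_{n\to\infty}\frac{\kappa_n}{n}=x$. Put $Y_n=n\,1_{\{T_n=\kappa_n\}}$. Then there exist an absolute positive constant $C_0$ and a positive constant $C$ (depending on $x$) such that for all integers $n>m\geqslant 2$, $$|\mathrm{Cov}(Y_m,Y_n)|\leqslant C\bigg\{\frac{n}{n-m}\chi^{(\boldsymbol\kappa,x)}_{m,n}+\frac{m}{n-m}+\chi^{(\boldsymbol\kappa,x)}_{2,n}+\frac1n\bigg\},$$ where $$\chi^{(\boldsymbol\kappa,x)}_{m,n}=\frac{n-m}{\kappa_n-\kappa_m}\cdot\frac{\log\frac nm}{\sqrt{n-m}}+\frac{n-m}{\kappa_n-\kappa_m}\cdot g_{m,n}+x\Big|\frac{n-m}{\kappa_n-\kappa_m}-\frac1x\Big|+\frac{m+1}{\kappa_n-\kappa_m}$$ and $$g_{m,n}=\exp\Bigg(C_0\Big\{\frac{\log\frac nm}{(n-m)^2}+\frac{m+2}{n-m}\Big\}\log^2\frac nm\Bigg)-1+\frac{1}{\log\frac nm}.$$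
   Context: $(Z_k)_{k\geqslant 1}$ are independent random variables with $P(Z_k=1)=\frac1k$ and $P(Z_k=0)=1-\frac1k$ for each $k$, and $T_n=\sum_{k=1}^n kZ_k$. $1_A$ denotes the indicator of the event $A$, and $\mathrm{Cov}$ denotes covariance.
   Formalization: The bound is proved for pairs n > m ≥ 2 with κ_n > κ_m and κ_n > κ_2: if a denominator κ_n−κ_m or κ_n−κ_2 is zero the right side is undefined, and if it is negative the right side can be negative, so the printed inequality fails. *)

(* Defs.v *)
From HB Require Import structures.
From mathcomp Require Import all_boot all_order all_algebra.
From mathcomp Require Import all_classical all_reals all_analysis.
Set Implicit Arguments.
Unset Strict Implicit.
Unset Printing Implicit Defensive.
Import Order.TTheory GRing.Theory Num.Theory.
Import numFieldNormedType.Exports.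
Local Open Scope classical_set_scope.
Local Open Scope ring_scope.

(* Mutual independence of the random variables X k, k ranging over D: the
   product rule for every finite set of distinct indices. *)
Definition mutually_independent (d : measure_display) (T : measurableType d)
    (R : realType) (P : probability T R) (D : set nat)
    (X : nat -> {RV P >-> R}) : Prop :=
  forall (s : seq nat) (B : nat -> set R),
    uniq s -> (forall k, k \in s -> D k) ->
    (forall k, k \in s -> measurable (B k)) ->
    P (\bigcap_(k in [set` s]) (X k @^-1` B k)) =
    (\prod_(k <- s) P (X k @^-1` B k))%E.

(* The index 0 is unused: Z_k is only constrained for k >= 1. *)
Definition harmonic_bernoulli (d : measure_display) (T : measurableType d)
    (R : realType) (P : probability T R) (Z : nat -> {RV P >-> R}) : Prop :=
  mutually_independent [set k | (1 <= k)%N] Z /\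
  forall k : nat, (1 <= k)%N ->
    P (Z k @^-1` [set 1]) = (1 / k%:R)%:E /\
    P (Z k @^-1` [set 0]) = (1 - 1 / k%:R)%:E.

Definition dickman_sum (d : measure_display) (T : measurableType d)
    (R : realType) (P : probability T R) (Z : nat -> {RV P >-> R})
    (n : nat) (w : T) : R :=
  \sum_(1 <= k < n.+1) k%:R * Z k w.

Definition Yvar (d : measure_display) (T : measurableType d)
    (R : realType) (P : probability T R) (Z : nat -> {RV P >-> R})
    (kappa : nat -> int) (n : nat) (w : T) : R :=
  n%:R * \1_[set v | dickman_sum Z n v = (kappa n)%:~R] w.

Definition gfun (R : realType) (C0 : R) (m n : nat) : R :=
  let L : R := ln (n%:R / m%:R) in
  let N : R := n%:R - m%:R in
  expR (C0 * (L / N ^+ 2 + (m%:R + 2) / N) * L ^+ 2) - 1 + 1 / L.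

(* Division is total; this is the intended quantity only when
   kappa n <> kappa m. *)
Definition chi (R : realType) (C0 : R) (kappa : nat -> int) (x : R)
    (m n : nat) : R :=
  let L : R := ln (n%:R / m%:R) in
  let N : R := n%:R - m%:R in
  let D : R := (kappa n)%:~R - (kappa m)%:~R in
  N / D * (L / Num.sqrt N) + N / D * gfun C0 m n
    + x * `|N / D - 1 / x| + (m%:R + 1) / D.

(* Main.v *)
Require Import Defs.
From HB Require Import structures.
From mathcomp Require Import all_boot all_order all_algebra.
From mathcomp Require Import all_classical all_reals all_analysis.
From mathcomp Require Import ring lra zify.
Import Order.TTheory GRing.Theory Num.Theory.
Import numFieldNormedType.Exports.
Local Open Scope classical_set_scope.
Local Open Scope ring_scope.
Set Implicit Arguments.
Unset Strict Implicit.
Unset Printing Implicit Defensive.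

(** Write q for the law of T_m, p for the law of T_n - T_m and a for
    kappa_n - kappa_m. By independence
      Cov(Y_m, Y_n) = m n q(kappa_m) (p(a) - sum_j q(j) p(kappa_n - j)),
    so it suffices that p is regular at the scale of n. Size biasing gives
      j p(j) = sum_{m < k <= n} P(T_n - T_m - k Z_k = j - k),
    and the right-hand side is within O((1 + log(n/m))/n) of the window
    probability P(j - n <= T_n - T_m < j - m). Forcing Z_k = 0 for h < k <= n
    shows P(T_n - T_m <= h) <= h/n, whence p(j) <= 2/n for j > 0, so that
    window probabilities are Lipschitz in j with constant O(1/n), up to O(m/n).
    Averaging over T_m, whose mean is m, bounds the covariance by
    O((log(n/m) + m)/a). If |x (n - m)/a - 1| >= 1/2 the right-hand side of the
    theorem is bounded below and the trivial bound 4 is enough; otherwise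
    m/a = O(m/(n - m)), and log(n/m)/a is dominated by the first term of chi.
    The exponential term of g plays no role, so C0 = 1 works. *)

(** * Product rule and polynomials with nonnegative coefficients *)

(** Since [r] has no repetition, the filter [j != i] removes exactly the differentiated factor. *)
Lemma deriv_prod_uniq (R : comNzRingType) (I : eqType) (r : seq I)
    (f : I -> {poly R}) : uniq r ->
  (\prod_(i <- r) f i)^`() =
  \sum_(i <- r) (f i)^`() * \prod_(j <- r | j != i) f j.
Proof.
elim: r => [|a r IHr] /=; first by rewrite !big_nil derivC.
move=> /andP[ar ur]; rewrite !big_cons derivM IHr// eqxx /=; congr (_ + _).
  congr (_ * _); rewrite [LHS]big_seq [RHS]big_seq_cond.
  by apply: eq_bigl => i; case: (boolP (i \in r)) => //= ir; apply/esym;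
     apply: contraNneq ar => <-.
rewrite mulr_sumr [LHS]big_seq [RHS]big_seq; apply: eq_bigr => i ir.
rewrite big_cons ifT; first by rewrite mulrCA.
by apply: contraNneq ar => ->.
Qed.

Definition coef_nneg (R : realFieldType) (p : {poly R}) := forall i, 0 <= p`_i.

Section NonnegativeCoefficients.
Variable R : realFieldType.
Implicit Types p q : {poly R}.

Lemma coef_nnegM p q : coef_nneg p -> coef_nneg q -> coef_nneg (p * q).
Proof.
by move=> p0 q0 i; rewrite coefM sumr_ge0// => j _; rewrite mulr_ge0.
Qed.

Lemma coef_nnegXn n : coef_nneg ('X^n : {poly R}).
Proof. by move=> i; rewrite coefXn. Qed.

Lemma coef_nneg_prod (I : eqType) (r : seq I) (P : pred I) (f : I -> {poly R}) :
  (forall i, i \in r -> coef_nneg (f i)) ->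
  coef_nneg (\prod_(i <- r | P i) f i).
Proof.
move=> f0; rewrite big_seq_cond; apply: big_ind => [i||i /andP[ir _]].
- by rewrite coef1.
- exact: coef_nnegM.
- exact: f0.
Qed.

Lemma sum_coef_le p h : coef_nneg p -> \sum_(i < h) p`_i <= p.[1].
Proof.
move=> p0; rewrite (@horner_coef_wide _ (maxn h (size p))) ?leq_maxr//.
under [leRHS]eq_bigr do rewrite expr1n mulr1.
rewrite -!(big_mkord xpredT (fun i => p`_i)).
rewrite [leRHS](big_cat_nat (leq0n h))/= ?leq_maxl//.
by rewrite lerDl sumr_ge0.
Qed.

Lemma sum_coefXnM_le p (h s : nat) : coef_nneg p ->
  \sum_(i < h) ('X^s * p)`_i <= p.[1].
Proof.
move=> p0; apply: le_trans (sum_coef_le h (coef_nnegM (coef_nnegXn s) p0)) _.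
by rewrite hornerM hornerXn expr1n mul1r.
Qed.

End NonnegativeCoefficients.

(** * Generating functions of T_n - T_m and size biasing *)

Definition bernoulli_poly (R : realFieldType) (k : nat) : {poly R} :=
  (1 - k%:R^-1)%:P + k%:R^-1 *: 'X^k.

(* Generating function of the law of T_n - T_m. *)
Definition dickman_poly (R : realFieldType) (m n : nat) : {poly R} :=
  \prod_(m.+1 <= k < n.+1) bernoulli_poly R k.

(** For m < k <= n, the generating function of T_n - T_m - k Z_k. *)
Definition dickman_poly_except (R : realFieldType) (m n k : nat) : {poly R} :=
  \prod_(m.+1 <= i < n.+1 | i != k) bernoulli_poly R i.

Section DickmanPoly.
Variable R : realFieldType.
Local Notation F := (dickman_poly R).
Local Notation Fx := (dickman_poly_except R).

Lemma bernoulli_poly_nneg k : (0 < k)%N -> coef_nneg (bernoulli_poly R k).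
Proof.
move=> k0 i; rewrite coefD coefC coefZ coefXn.
have k1 : 0 <= 1 - k%:R^-1 :> R.
  by rewrite subr_ge0 invf_le1 ?ler1n ?ltr0n.
by apply: addr_ge0; [case: ifP | rewrite mulr_ge0 ?invr_ge0].
Qed.

Lemma bernoulli_poly1 k : (bernoulli_poly R k).[1] = 1.
Proof. by rewrite !hornerE expr1n mulr1 subrK. Qed.

(** The exponent k produced by the derivative cancels the probability 1/k, so the size-bias identity
    carries no weights. *)
Lemma XM_deriv_bernoulli_poly k : (0 < k)%N ->
  'X * (bernoulli_poly R k)^`() = 'X^k.
Proof.
case: k => // k _; rewrite derivD derivC add0r derivZ derivXn /=.
rewrite -scalerMnr scalerMnl -mulr_natr mulVf ?pnatr_eq0// scale1r.
by rewrite -exprS.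
Qed.

Lemma dickman_poly_nneg m n : coef_nneg (F m n).
Proof.
apply: coef_nneg_prod => k; rewrite mem_index_iota => /andP[mk _].
by apply: bernoulli_poly_nneg; apply: leq_trans mk.
Qed.

Lemma dickman_poly_except_nneg m n k : coef_nneg (Fx m n k).
Proof.
apply: coef_nneg_prod => i; rewrite mem_index_iota => /andP[mi _].
by apply: bernoulli_poly_nneg; apply: leq_trans mi.
Qed.

Lemma dickman_poly1 m n : (F m n).[1] = 1.
Proof.
rewrite /dickman_poly (big_morph (fun p => p.[1]) (id1 := 1) (op1 := *%R))
  ?hornerC//; last by move=> p q; rewrite hornerM.
by rewrite big1// => k _; exact: bernoulli_poly1.
Qed.

Lemma dickman_poly_except1 m n k : (Fx m n k).[1] = 1.
Proof.
rewrite /dickman_poly_except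
  (big_morph (fun p => p.[1]) (id1 := 1) (op1 := *%R))
  ?hornerC//; last by move=> p q; rewrite hornerM.
by rewrite big1// => i _; exact: bernoulli_poly1.
Qed.

Lemma dickman_polynn n : F n n = 1.
Proof. by rewrite /dickman_poly big_geq. Qed.

Lemma dickman_polyS m n : (m <= n)%N ->
  F m n.+1 = bernoulli_poly R n.+1 * F m n.
Proof. by move=> mn; rewrite /dickman_poly big_nat_recr//= mulrC. Qed.

Lemma dickman_poly_cat m n l : (m <= n)%N -> (n <= l)%N ->
  F m l = F m n * F n l.
Proof. by move=> mn nl; rewrite /dickman_poly (big_cat_nat (n := n.+1)). Qed.

Lemma dickman_polyD1 m n k : (m < k <= n)%N ->
  F m n = bernoulli_poly R k * Fx m n k.
Proof.
move=> mkn; rewrite /dickman_poly (bigD1_seq k) ?iota_uniq//=.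
by rewrite mem_index_iota.
Qed.

Lemma coef_bernoulli_polyM k (p : {poly R}) i :
  (bernoulli_poly R k * p)`_i =
  (1 - k%:R^-1) * p`_i + k%:R^-1 * ('X^k * p)`_i.
Proof. by rewrite mulrDl coefD coefCM -scalerAl coefZ. Qed.

(* Size biasing: j P(T = j) is the sum over k of k P(Z_k = 1, T = j). *)
Lemma size_bias m n :
  'X * (F m n)^`() = \sum_(m.+1 <= k < n.+1) 'X^k * Fx m n k.
Proof.
rewrite /dickman_poly deriv_prod_uniq ?iota_uniq// mulr_sumr.
rewrite big_nat [RHS]big_nat; apply: eq_bigr => k /andP[mk _].
by rewrite mulrA XM_deriv_bernoulli_poly//; apply: leq_trans mk.
Qed.

Lemma coef_size_bias m n j :
  j%:R * (F m n)`_j = \sum_(m.+1 <= k < n.+1) ('X^k * Fx m n k)`_j.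
Proof.
rewrite -coef_sum -size_bias coefXM; case: j => [|j] /=; first by rewrite mul0r.
by rewrite coef_deriv mulr_natl.
Qed.

(** A truncated mean: after size biasing, each k in (m, n] contributes total mass at most 1. *)
Lemma sum_mul_coef_le m n h : (m <= n)%N ->
  \sum_(j < h) j%:R * (F m n)`_j <= (n - m)%:R.
Proof.
move=> mn; under eq_bigr do rewrite coef_size_bias.
rewrite exchange_big/= -subSS -[leRHS]mulr1 mulr_natl -sumr_const_nat.
apply: ler_sum => k _; apply: le_trans (sum_coefXnM_le _ _ _) _.
  exact: dickman_poly_except_nneg.
by rewrite dickman_poly_except1.
Qed.

Lemma coef_XnMD1 m n k s j : (m < k <= n)%N ->
  ('X^s * F m n)`_j = (1 - k%:R^-1) * ('X^s * Fx m n k)`_j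
                      + k%:R^-1 * ('X^(s + k) * Fx m n k)`_j.
Proof.
move=> /dickman_polyD1 ->; rewrite mulrCA coef_bernoulli_polyM.
by rewrite [in 'X^_ * ('X^_ * _)]mulrA -exprD addnC.
Qed.

(** As k >= 2, the event Z_k = 0 has probability at least 1/2, so removing the factor k costs at
    most a factor 2. *)
Lemma coef_except_le m n k s j : (0 < m)%N -> (m < k <= n)%N ->
  ('X^s * Fx m n k)`_j <= 2 * ('X^s * F m n)`_j.
Proof.
move=> m0 /[dup] /andP[mk _] mkn; rewrite (coef_XnMD1 s j mkn).
have : (k%:R : R)^-1 <= 2^-1 by rewrite lef_pV2 ?posrE ?ltr0n ?ler_nat//; lia.
have : 0 <= (k%:R : R)^-1 by rewrite invr_ge0.
have := coef_nnegM (coef_nnegXn _ s) (dickman_poly_except_nneg m n k) j.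
have := coef_nnegM (coef_nnegXn _ (s + k)) (dickman_poly_except_nneg m n k) j.
by nra.
Qed.

Lemma coef_size_bias_le m n j : (0 < m)%N ->
  j%:R * (F m n)`_j <= 2 * \sum_(m.+1 <= k < n.+1) ('X^k * F m n)`_j.
Proof.
move=> m0; rewrite coef_size_bias mulr_sumr; apply: ler_sum_nat => k mkn.
exact: coef_except_le.
Qed.

(** The shifts by k in (m, n] pick out the indices j - n, ..., j - m - 1. Truncated subtraction cuts
    this window off at 0, as [coefXnM] does. *)
Lemma sum_window m n (p : {poly R}) j : (m <= n)%N ->
  \sum_(m.+1 <= k < n.+1) ('X^k * p)`_j =
  \sum_(i < j - m) p`_i - \sum_(i < j - n) p`_i.
Proof.
elim: n => [|n IHn]; first by rewrite leqn0 => /eqP ->; rewrite big_geq// subrr.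
rewrite leq_eqVlt => /predU1P[->|mn]; first by rewrite big_geq// subrr.
rewrite big_nat_recr//= IHn// coefXnM; case: ltnP => jn.
  by rewrite (_ : j - n.+1 = j - n)%N ?addr0//; lia.
by rewrite (_ : j - n = (j - n.+1).+1)%N ?big_ord_recr/=; [ring | lia].
Qed.

Lemma sum_window_le m n j : (m <= n)%N ->
  \sum_(m.+1 <= k < n.+1) ('X^k * F m n)`_j <= \sum_(i < j - m) (F m n)`_i.
Proof.
move=> mn; rewrite sum_window// gerBl sumr_ge0// => i _.
exact: dickman_poly_nneg.
Qed.

(** * Pointwise bounds on the law of T_n - T_m *)

(** A value i <= h forces Z_k = 0 for h < k <= n, and the product of the 1 - 1/k telescopes to
    h/n. *)
Lemma coef_dickman_poly_restrict m h n i : (m <= h)%N -> (h <= n)%N ->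
  (i <= h)%N -> n%:R * (F m n)`_i = h%:R * (F m h)`_i.
Proof.
move=> mh + ih; elim: n => [|n IHn]; first by rewrite leqn0 => /eqP ->.
rewrite leq_eqVlt => /predU1P[-> //|hn].
rewrite dickman_polyS ?(leq_trans mh)// coef_bernoulli_polyM coefXnM ltnS.
rewrite (leq_trans ih)// mulr0 addr0 mulrA mulrBr mulr1 mulfV ?pnatr_eq0//.
by rewrite -natr1 addrK IHn.
Qed.

Lemma sum_coef_le_div m n h : (m <= n)%N -> (m <= h)%N ->
  n%:R * (\sum_(i < h.+1) (F m n)`_i) <= h%:R.
Proof.
move=> mn mh; have [hn|nh] := leqP h n.
  rewrite mulr_sumr; under eq_bigr => i _ do
    rewrite (coef_dickman_poly_restrict mh hn (ltn_ord i)).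
  rewrite -mulr_sumr -[leRHS]mulr1 ler_wpM2l//.
  rewrite -(dickman_poly1 m h); apply: sum_coef_le; exact: dickman_poly_nneg.
apply: (@le_trans _ _ n%:R); last by rewrite ler_nat ltnW.
rewrite -[leRHS]mulr1 ler_wpM2l// -(dickman_poly1 m n).
by apply: sum_coef_le; exact: dickman_poly_nneg.
Qed.

Lemma coef0_dickman_poly m n : (m <= n)%N -> n%:R * (F m n)`_0 = m%:R.
Proof.
move=> mn; rewrite (coef_dickman_poly_restrict (leqnn m))// dickman_polynn.
by rewrite coef1 mulr1.
Qed.

(** Size biasing bounds i p(i) by twice the mass below i - m, which is at most i/n; then i
    cancels. *)
Lemma coef_dickman_poly_le m n i : (0 < m)%N -> (m <= n)%N -> (0 < i)%N ->
  n%:R * (F m n)`_i <= 2.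
Proof.
move=> m0 mn i0; have i0' : 0 < i%:R :> R by rewrite ltr0n.
rewrite -(ler_pM2l i0') mulrCA.
apply: (@le_trans _ _ (n%:R * (2 * \sum_(k < i - m) (F m n)`_k))).
  rewrite ler_wpM2l// (le_trans (coef_size_bias_le _ _ m0))//.
  by rewrite ler_wpM2l// sum_window_le.
have [im|mi] := leqP i m.
  have /eqP -> : (i - m == 0)%N by rewrite subn_eq0.
  by rewrite big_ord0 !mulr0 mulr_ge0.
rewrite mulrCA [leRHS]mulrC ler_wpM2l//.
apply: le_trans (sum_coef_le_div mn (ltnW mi)).
rewrite ler_wpM2l// -!(big_mkord xpredT (fun i => (F m n)`_i)).
rewrite [leRHS](big_cat_nat (leq0n (i - m)))/=; last lia.
by rewrite lerDl sumr_ge0// => k _; exact: dickman_poly_nneg.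
Qed.

(** The indicator accounts for the atom at 0, of mass exactly m/n. *)
Lemma coef_dickman_poly_le_all m n i : (0 < m)%N -> (m <= n)%N ->
  n%:R * (F m n)`_i <= 2 + m%:R * (i == 0%N)%:R.
Proof.
move=> m0 mn; case: i => [|i].
  by rewrite coef0_dickman_poly// mulr1 lerDr.
by rewrite mulr0 addr0 coef_dickman_poly_le.
Qed.

Lemma coef_dickman_poly_increment m n h h' : (0 < m)%N -> (m <= n)%N ->
  (h <= h')%N ->
  n%:R * `|\sum_(i < h') (F m n)`_i - \sum_(i < h) (F m n)`_i|
    <= 2 * (h'%:R - h%:R) + m%:R.
Proof.
move=> m0 mn hh'; rewrite -!(big_mkord xpredT (fun i => (F m n)`_i)).
rewrite (big_cat_nat (leq0n h) hh')/= addrAC subrr add0r ger0_norm; last first.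
  by rewrite sumr_ge0// => i _; exact: dickman_poly_nneg.
elim: h' hh' => [|k IHk].
  by rewrite leqn0 => /eqP ->; rewrite big_geq// subrr !mulr0 add0r.
rewrite leq_eqVlt => /predU1P[->|hk].
  by rewrite big_geq// subrr !mulr0 add0r.
(* The atom at 0 enters only for k = 0, hence h = 0, and supplies the single m of the bound. *)
rewrite big_nat_recr//= mulrDr; have [k0|k0] := posnP k.
  move: hk; rewrite k0 ltnS leqn0 => /eqP ->.
  have := coef_dickman_poly_le_all 0 m0 mn.
  by rewrite big_geq// mulr0 add0r subr0 !mulr1.
have := IHk hk; have := coef_dickman_poly_le m0 mn k0.
by rewrite -natr1; lra.
Qed.

(** * Window probabilities and regularity of the law *)

(** This is P(j - n <= T_n - T_m < j - m), written as a sum over k for termwise comparison with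
    [coef_size_bias]. *)
Definition window_sum m n j : R := \sum_(m.+1 <= k < n.+1) ('X^k * F m n)`_j.

(** Each of the two ends of the window moves by at most |a - b| and sweeps over mass at most (2 |a -
    b| + m)/n. *)
Lemma window_sum_lipschitz m n a b : (0 < m)%N -> (m <= n)%N ->
  n%:R * `|window_sum m n a - window_sum m n b|
    <= 4 * `|a%:R - b%:R| + 2 * m%:R.
Proof.
move=> m0 mn; wlog ab : a b / (a <= b)%N.
  move=> H; have [/H//|/ltnW/H] := leqP a b.
  by rewrite distrC [in X in _ <= X -> _]distrC.
have abR : a%:R <= b%:R :> R by rewrite ler_nat.
have shift s :
    (a - s <= b - s)%N /\ (b - s)%:R - (a - s)%:R <= b%:R - a%:R :> R.
  by split; first lia; rewrite -!natrB ?ler_nat//; lia.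
have [am amb] := shift m; have [an anb] := shift n.
have := coef_dickman_poly_increment m0 mn am.
have := coef_dickman_poly_increment m0 mn an.
rewrite /window_sum !sum_window// [`|a%:R - _|]distrC.
rewrite (ger0_norm (_ : 0 <= b%:R - a%:R)) ?subr_ge0//.
set Sbn := \sum_(i < b - n) _; set San := \sum_(i < a - n) _.
set Sbm := \sum_(i < b - m) _; set Sam := \sum_(i < a - m) _.
have : `|Sam - San - (Sbm - Sbn)| <= `|Sbm - Sam| + `|Sbn - San|.
  rewrite (_ : _ - _ = (Sam - Sbm) - (San - Sbn)); last by ring.
  by rewrite (le_trans (ler_normB _ _))// distrC [`|San - _|]distrC.
by move=> /(ler_wpM2l (ler0n R n)); rewrite mulrDr; lra.
Qed.

Lemma sum_indicator_le1 a b c : \sum_(a <= k < b) (k == c)%:R <= 1 :> R.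
Proof.
have [cab|/negPf cab] := boolP (c \in index_iota a b).
  rewrite (bigD1_seq c) ?iota_uniq//= eqxx big1 ?addr0// => i /negPf ic.
  by rewrite ic.
rewrite big_seq big1 ?ler01// => i iab; case: eqP => // ic.
by rewrite -ic iab in cab.
Qed.

Definition harmonic_sum m n : R := \sum_(m.+1 <= k < n.+1) k%:R^-1.

Lemma coef_XnM_le m n s j : (0 < m)%N -> (m <= n)%N ->
  n%:R * ('X^s * F m n)`_j <= 2 + m%:R * (j == s)%:R.
Proof.
move=> m0 mn; rewrite coefXnM; case: ltnP => js.
  by rewrite mulr0 addr_ge0// mulr_ge0.
apply: le_trans (coef_dickman_poly_le_all _ m0 mn) _.
by rewrite lerD2l ler_wpM2l// ler_nat; case: eqP; case: eqP => //; lia.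
Qed.

(** Restoring the factor k changes the k-th term by (x - y)/k, with x and y of order 1/n unless j =
    k or j = 2k. In these cases the atom at 0 adds a multiple of m/n, and m/k <= 1 keeps its cost
    bounded. *)
Lemma size_bias_window m n j : (0 < m)%N -> (m <= n)%N ->
  n%:R * `|j%:R * (F m n)`_j - window_sum m n j| <= 8 * harmonic_sum m n + 4.
Proof.
move=> m0 mn; rewrite coef_size_bias /window_sum -sumrB.
have term k : (m < k < n.+1)%N ->
    n%:R * `|('X^k * Fx m n k)`_j - ('X^k * F m n)`_j| <=
    (* The equality j = 2k is weakened to [k == j./2], so that [sum_indicator_le1] applies to the
       sum over k. *)
    8 * k%:R^-1 + 2 * (k == j)%:R + 2 * (k == j./2)%:R.
  move=> mkn; have mk : (m < k)%N by case/andP: mkn.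
  have k0 : 0 < k%:R :> R by rewrite ltr0n; lia.
  have x0 := coef_nnegM (coef_nnegXn _ k) (dickman_poly_except_nneg m n k) j.
  have y0 := coef_nnegM (coef_nnegXn _ (k + k))
    (dickman_poly_except_nneg m n k) j.
  have x1 := coef_except_le k j m0 mkn.
  have y1 := coef_except_le (k + k) j m0 mkn.
  have x2 := coef_XnM_le k j m0 mn.
  have y2 := coef_XnM_le (k + k) j m0 mn.
  rewrite (coef_XnMD1 k j mkn).
  set x := ('X^k * Fx m n k)`_j in x0 x1 *.
  set y := ('X^(k + k) * Fx m n k)`_j in y0 y1 *.
  rewrite (_ : x - _ = k%:R^-1 * (x - y)); last by ring.
  rewrite normrM ger0_norm ?invr_ge0// mulrCA mulrC ler_pdivrMr//.
  have jk : (j == k)%:R = (k == j)%:R :> R by rewrite eq_sym.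
  have jkk : (j == k + k)%N%:R <= (k == j./2)%:R :> R.
    by rewrite ler_nat; case: eqP; case: eqP => //; lia.
  have mk' : m%:R <= k%:R :> R by rewrite ler_nat ltnW.
  have n0 : 0 <= n%:R :> R by [].
  apply: (@le_trans _ _ (n%:R * x + n%:R * y)).
    rewrite -mulrDr ler_wpM2l// (le_trans (ler_normB _ _))//.
    by rewrite !ger0_norm.
  have kVk : 8 * k%:R^-1 * k%:R = 8 :> R by rewrite -mulrA mulVf ?gt_eqF ?mulr1.
  have : m%:R * (j == k)%:R <= k%:R * (k == j)%:R :> R.
    by rewrite jk ler_wpM2r.
  have : m%:R * (j == k + k)%N%:R <= k%:R * (k == j./2)%:R :> R.
    by rewrite ler_pM.
  have := ler_wpM2l n0 x1; have := ler_wpM2l n0 y1.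
  lra.
apply: (@le_trans _ _ (\sum_(m.+1 <= k < n.+1)
    (8 * k%:R^-1 + 2 * (k == j)%:R + 2 * (k == j./2)%:R))).
  apply: (@le_trans _ _ (n%:R * \sum_(m.+1 <= k < n.+1)
    `|('X^k * Fx m n k)`_j - ('X^k * F m n)`_j|)).
    by rewrite ler_wpM2l// ler_norm_sum.
  by rewrite mulr_sumr; apply: ler_sum_nat.
rewrite !big_split/= -!mulr_sumr -/(harmonic_sum m n).
have := sum_indicator_le1 m.+1 n.+1 j; have := sum_indicator_le1 m.+1 n.+1 j./2.
lra.
Qed.

(** With G the window sum, a (p(a) - p(b)) splits into the size-bias errors at a and b, the
    difference G(a) - G(b), and -(a - b) p(b). The coefficient 6 is 4 from the Lipschitz bound plus
    2 from n p(b). *)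
Lemma coef_dickman_poly_diff m n a b : (0 < m)%N -> (m <= n)%N ->
  a%:R * (n%:R * `|(F m n)`_a - (F m n)`_b|) <=
  16 * harmonic_sum m n + 8 + 2 * m%:R
  + (6 + m%:R * (b == 0%N)%:R) * `|a%:R - b%:R|.
Proof.
move=> m0 mn; have Ea := size_bias_window a m0 mn.
have Eb := size_bias_window b m0 mn.
have Gab := window_sum_lipschitz a b m0 mn.
have pb := coef_dickman_poly_le_all b m0 mn.
have pb0 := dickman_poly_nneg m n b.
have n0 : 0 <= n%:R :> R by [].
set pa := (F m n)`_a in Ea *; set p := (F m n)`_b in Eb pb pb0 *.
set Ga := window_sum m n a in Ea Gab; set Gb := window_sum m n b in Eb Gab.
rewrite mulrCA -[X in n%:R * (X * _)]ger0_norm// -normrM.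
have -> : a%:R * (pa - p) = (a%:R * pa - Ga) - (b%:R * p - Gb) + (Ga - Gb)
    - (a%:R - b%:R) * p by ring.
apply: (@le_trans _ _ (n%:R * (`|a%:R * pa - Ga| + `|b%:R * p - Gb|
    + `|Ga - Gb| + `|a%:R - b%:R| * p))).
  rewrite ler_wpM2l// (le_trans (ler_normB _ _))// normrM (ger0_norm pb0).
  rewrite lerD2r (le_trans (ler_normD _ _))// lerD2r.
  exact: ler_normB.
have := ler_wpM2l (normr_ge0 (a%:R - b%:R : R)) pb.
lra.
Qed.

(** * The law of T_m and the decorrelation estimate *)

(** Z_1 = 1 almost surely. This reduces T_m to T_m - T_1, whose lower index is positive as the
    earlier bounds require. *)
Lemma dickman_poly0 m : (0 < m)%N -> F 0 m = 'X * F 1 m.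
Proof.
move=> m0; rewrite (dickman_poly_cat (n := 1))// dickman_polyS// dickman_polynn.
by rewrite mulr1 /bernoulli_poly invr1 subrr add0r scale1r expr1.
Qed.

Lemma coef_dickman_poly0_le m i : (0 < m)%N -> m%:R * (F 0 m)`_i <= 2.
Proof.
move=> m0; rewrite dickman_poly0// coefXM; case: i => [|[|i]] /=.
- by rewrite mulr0.
- by rewrite coef0_dickman_poly// ler1n.
- exact: coef_dickman_poly_le.
Qed.

(** Size biasing for T_m - T_1 gives at most 2, the window having mass at most 1; the shift by Z_1
    adds at most 1. *)
Lemma mul_coef_dickman_poly0_le m i : (0 < m)%N -> i%:R * (F 0 m)`_i <= 4.
Proof.
move=> m0; rewrite dickman_poly0// coefXM; case: i => [|i] /=.
  by rewrite mulr0.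
have S1 h : \sum_(k < h) (F 1 m)`_k <= 1.
  rewrite -(dickman_poly1 1 m); apply: sum_coef_le; exact: dickman_poly_nneg.
have := S1 (i - 1)%N; have := S1 i.+1; rewrite big_ord_recr/=.
have : 0 <= \sum_(k < i) (F 1 m)`_k.
  by rewrite sumr_ge0// => k _; exact: dickman_poly_nneg.
have := coef_size_bias_le m i (ltn0Sn 0).
have := sum_window_le i m0.
rewrite -natr1; lra.
Qed.

(** Markov's inequality for T_m, whose mean is m. *)
Lemma dickman_poly0_tail m K : 
  K%:R * (1 - \sum_(j < K.+1) (F 0 m)`_j) <= m%:R.
Proof.
(* Beyond the size all coefficients vanish, so those below [h] sum to 1. *)
set h := maxn K.+1 (size (F 0 m)).
have F1 : 1 = \sum_(j < h) (F 0 m)`_j.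
  rewrite -(dickman_poly1 0 m) (@horner_coef_wide _ h) ?leq_maxr//.
  by apply: eq_bigr => j _; rewrite expr1n mulr1.
have := sum_mul_coef_le h (leq0n m); rewrite subn0 => /(le_trans _); apply.
rewrite [X in X - _]F1 -!(big_mkord xpredT (fun j => (F 0 m)`_j)).
rewrite -(big_mkord xpredT (fun j => j%:R * (F 0 m)`_j)).
have Kh : (K.+1 <= h)%N by rewrite leq_maxl.
rewrite (big_cat_nat (leq0n K.+1) Kh)/= addrAC subrr add0r.
rewrite [leRHS](big_cat_nat (leq0n K.+1) Kh)/= mulr_sumr.
apply: ler_wpDl.
  by rewrite sumr_ge0// => j _; rewrite mulr_ge0// dickman_poly_nneg.
apply: ler_sum_nat => j /andP[Kj _]; rewrite ler_wpM2r ?dickman_poly_nneg//.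
by rewrite ler_nat ltnW.
Qed.

(** With K = i + a, P(T_n = K) is the convolution of q and p at K. Hence its difference from p(a) is
    the q-average of p(a) - p(K - j) over j <= K, plus p(a) P(T_m > K). The arguments a and K - j
    differ by |i - j|, of mean at most i + m. *)
Lemma coef_dickman_poly_decorrelation m n i a :
  (0 < m)%N -> (m <= n)%N -> (0 < a)%N ->
  m%:R * n%:R * (F 0 m)`_i * `|(F m n)`_a - (F 0 n)`_(i + a)| <=
  (32 * harmonic_sum m n + 68 * m%:R) / a%:R.
Proof.
move=> m0 mn a0; have a0R : 0 < a%:R :> R by rewrite ltr0n.
set K := (i + a)%N; set q := F 0 m; set p := F m n.
have q0 j : 0 <= q`_j by exact: dickman_poly_nneg.
have H0 : 0 <= harmonic_sum m n by rewrite sumr_ge0// => k _; rewrite invr_ge0.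
have m1 : 1 <= m%:R :> R by rewrite ler1n.
have tail0 : 0 <= 1 - \sum_(j < K.+1) q`_j.
  rewrite subr_ge0 -(dickman_poly1 0 m); apply: sum_coef_le.
  exact: dickman_poly_nneg.
(* [c] collects the terms free of j once |a - (K - j)| <= i + j is inserted. The 12 m below is 6 m
   from the mean of T_m, 4 m from the atom at j = K and 2 m from the tail. *)
pose c : R := 16 * harmonic_sum m n + 8 + 2 * m%:R + 6 * i%:R.
have bound : a%:R * (n%:R * `|p`_a - (F 0 n)`_K|) <= c + 12 * m%:R.
  have -> : p`_a - (F 0 n)`_K = \sum_(j < K.+1) q`_j * (p`_a - p`_(K - j))
      + p`_a * (1 - \sum_(j < K.+1) q`_j).
    rewrite (dickman_poly_cat (leq0n m) mn) coefM -/q -/p.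
    have -> : \sum_(j < K.+1) q`_j * (p`_a - p`_(K - j)) =
        (\sum_(j < K.+1) q`_j) * p`_a - \sum_(j < K.+1) q`_j * p`_(K - j).
      by rewrite mulr_suml -sumrB; apply: eq_bigr => j _; rewrite mulrBr.
    ring.
  apply: (@le_trans _ _
      (\sum_(j < K.+1) q`_j * (a%:R * (n%:R * `|p`_a - p`_(K - j)|))
      + (n%:R * p`_a) * (a%:R * (1 - \sum_(j < K.+1) q`_j)))).
    have -> : \sum_(j < K.+1) q`_j * (a%:R * (n%:R * `|p`_a - p`_(K - j)|)) =
        a%:R * (n%:R * \sum_(j < K.+1) `|q`_j * (p`_a - p`_(K - j))|).
      rewrite !mulr_sumr; apply: eq_bigr => j _.
      by rewrite normrM (ger0_norm (q0 _)); ring.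
    rewrite (_ : n%:R * p`_a * _ =
      a%:R * (n%:R * (p`_a * (1 - \sum_(j < K.+1) q`_j)))); last by ring.
    rewrite -!mulrDr !ler_wpM2l// (le_trans (ler_normD _ _))//.
    rewrite lerD ?ler_norm_sum//.
    by rewrite ger0_norm// mulr_ge0//; exact: dickman_poly_nneg.
  have tail : n%:R * p`_a * (a%:R * (1 - \sum_(j < K.+1) q`_j)) <= 2 * m%:R.
    rewrite ler_pM ?mulr_ge0//; first exact: dickman_poly_nneg.
      exact: coef_dickman_poly_le.
    apply: le_trans (dickman_poly0_tail m K); rewrite ler_wpM2r//.
    by rewrite ler_nat leq_addl.
  have sum_le : \sum_(j < K.+1) q`_j * (a%:R * (n%:R * `|p`_a - p`_(K - j)|)) <=
      \sum_(j < K.+1) (c * q`_j + 6 * (j%:R * q`_j)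
                       + 4 * m%:R * (j == K :> nat)%:R).
    apply: ler_sum => j _; have jK : (j <= K)%N by rewrite -ltnS.
    have := ler_wpM2l (q0 j) (coef_dickman_poly_diff a (K - j) m0 mn).
    move=> /le_trans; apply.
    have ij : `|a%:R - (K - j)%:R| <= i%:R + j%:R :> R.
      have := ler0n R i; have := ler0n R j.
      by rewrite natrB// natrD ler_norml; lra.
    (* For j = K the atom p(0) contributes m a q_j, which is at most m j q_j <= 4 m because a <=
       K. *)
    have [Kj|Kj] := eqVneq (K - j)%N 0%N.
      have -> : (j == K :> nat) by apply/eqP; lia.
      rewrite Kj subr0 (ger0_norm (ltW a0R)) !mulr1.
      have : a%:R <= i%:R + j%:R :> R by rewrite Kj subr0 ger0_norm in ij.
      have : a%:R <= j%:R :> R by rewrite ler_nat; lia.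
      have := mul_coef_dickman_poly0_le j m0; rewrite -/q.
      have := q0 j; move: (q`_j) => x x0 x4 aj aij.
      have : x * a%:R <= x * j%:R by rewrite ler_wpM2l.
      have : x * a%:R <= x * (i%:R + j%:R) by rewrite ler_wpM2l.
      rewrite /c => h1 h2.
      have : m%:R * (x * a%:R) <= m%:R * 4 by rewrite ler_wpM2l//; lra.
      lra.
    rewrite mulr0 addr0; have := ler_wpM2l (q0 j) ij.
    have : 0 <= m%:R * (j == K :> nat)%:R :> R by rewrite mulr_ge0.
    rewrite /c; lra.
  apply: le_trans (lerD sum_le tail) _.
  rewrite !big_split/= -!mulr_sumr.
  have := sum_mul_coef_le K.+1 (leq0n m); rewrite -/q subn0.
  have := sum_indicator_le1 0 K.+1 K; rewrite big_mkord => h1.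
  have : c * \sum_(j < K.+1) q`_j <= c * 1.
    have i0 := ler0n R i.
    by rewrite ler_wpM2l//; [rewrite /c; lra | rewrite -subr_ge0].
  have : 4 * m%:R * \sum_(i0 < K.+1) (i0 == K :> nat)%:R <= 4 * m%:R * 1 :> R.
    by rewrite ler_wpM2l// mulr_ge0.
  lra.
rewrite ler_pdivlMr//.
rewrite (_ : _ * a%:R = (m%:R * q`_i) * (a%:R * (n%:R * `|p`_a - (F 0 n)`_K|)));
  last by ring.
(* Using m q_i <= 2 and i q_i <= 4, the total is 2 (16 H + 8 + 14 m) + 24 m with H the harmonic sum,
   and 16 + 52 m <= 68 m since m >= 1. *)
have mq0 : 0 <= m%:R * q`_i by rewrite mulr_ge0.
have := ler_wpM2l mq0 bound.
have : (m%:R * q`_i) * (16 * harmonic_sum m n + 8 + 14 * m%:R) <=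
   2 * (16 * harmonic_sum m n + 8 + 14 * m%:R).
  by rewrite ler_wpM2r ?coef_dickman_poly0_le//; lra.
have : m%:R * (i%:R * q`_i) <= m%:R * 4.
  by rewrite ler_wpM2l// mul_coef_dickman_poly0_le.
rewrite /c; lra.
Qed.

End DickmanPoly.

(** * From coefficients to probabilities and the covariance *)

(** Extension by 0 to negative indices: [kappa] is integer-valued, and j - k may be negative in the
    recursion. *)
Definition coefz (R : realFieldType) (p : {poly R}) (j : int) : R :=
  if j is Posz i then p`_i else 0.

Lemma coefz_bernoulli_polyM (R : realFieldType) k (p : {poly R}) j :
  (0 < k)%N ->
  coefz (bernoulli_poly R k * p) j =
  (1 - k%:R^-1) * coefz p j + k%:R^-1 * coefz p (j - k%:Z).
Proof.
move=> k0; case: j => [i|i]; last first.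
  rewrite mulr0 add0r (_ : Negz i - k%:Z = Negz (i + k)); last lia.
  by rewrite mulr0.
rewrite [LHS]coef_bernoulli_polyM coefXnM; congr (_ + _ * _).
case: ltnP => ik.
  by rewrite (_ : i%:Z - k%:Z = Negz (k - i).-1)//; lia.
by rewrite subzn.
Qed.

Section Law.
Variables (d : measure_display) (T : measurableType d) (R : realType).
Variables (P : probability T R) (Z : nat -> {RV P >-> R}).
Hypothesis hZ : harmonic_bernoulli Z.

Lemma measurable_preimage_RV k (B : set R) : measurable B ->
  measurable (Z k @^-1` B).
Proof.
by move=> mB; rewrite -[X in measurable X]setTI; exact: measurable_funPT.
Qed.

Lemma measurable_bigcap_seq (s : seq nat) (B : nat -> set R) :
  (forall k, k \in s -> measurable (B k)) ->
  measurable (\bigcap_(k in [set` s]) (Z k @^-1` B k)).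
Proof.
move=> mB; apply: fin_bigcap_measurable; first exact: finite_seq.
by move=> k /= ks; apply: measurable_preimage_RV; exact: mB.
Qed.

(* A has probability c and is independent of the Z_k with k > n. *)
Definition indep_after (n : nat) (A : set T) (c : R) : Prop :=
  measurable A /\
  forall (s : seq nat) (B : nat -> set R), uniq s ->
    (forall k, k \in s -> (n < k)%N) ->
    (forall k, k \in s -> measurable (B k)) ->
    P (A `&` \bigcap_(k in [set` s]) (Z k @^-1` B k)) =
    (c%:E * \prod_(k <- s) P (Z k @^-1` B k))%E.

Lemma indep_after_setT : indep_after 0 setT 1.
Proof.
split=> // s B us s0 mB; rewrite setTI mul1e.
exact: (proj1 hZ).
Qed.

Lemma indep_after_prob n A c : indep_after n A c -> P A = c%:E.
Proof.
case=> _ /(_ [::] (fun=> setT)) H.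
by rewrite -[A]setIT -[setT](bigcap_set0 (fun k => Z k @^-1` setT)) -set_nil H//
  big_nil mule1.
Qed.

Lemma indep_after_cond n A c b (B : set R) : indep_after n A c ->
  measurable B -> P (Z n.+1 @^-1` B) = b%:E ->
  indep_after n.+1 (A `&` Z n.+1 @^-1` B) (c * b).
Proof.
case=> mA H mB Pb; split; first exact: measurableI (measurable_preimage_RV _ _).
move=> s C us sn mC.
(* Gluing [B] at [n.+1] to [C] on [s] turns the claim into the hypothesis for the list
   [n.+1 :: s]. *)
pose D k := if k == n.+1 then B else C k.
have ns : n.+1 \notin s by apply/negP => /sn; rewrite ltnn.
have eqD k : k \in s -> D k = C k.
  by rewrite /D; case: eqP => // -> ks; rewrite ks in ns.
have Dn : D n.+1 = B by rewrite /D eqxx.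
have := H (n.+1 :: s) D; rewrite /= us ns big_cons Dn Pb EFinM muleA.
have -> : \bigcap_(k in [set` n.+1 :: s]) Z k @^-1` D k =
    Z n.+1 @^-1` B `&` \bigcap_(k in [set` s]) Z k @^-1` C k.
  rewrite !bigcap_seq big_cons Dn; congr (_ `&` _).
  by apply: eq_big_seq => k /eqD ->.
rewrite setIA => ->//; first by congr (_ * _)%E; apply: eq_big_seq => k /eqD ->.
  by move=> k; rewrite inE => /predU1P[->//|/sn/ltnW].
move=> k; rewrite inE /D; case: eqP => //= _; exact: mC.
Qed.

Lemma indep_after_null n A : measurable A -> P A = 0%E -> indep_after n A 0.
Proof.
move=> mA PA0; split=> // s B _ _ mB; rewrite mul0e.
apply: (subset_measure0 (B := A)) => //.
by apply: measurableI => //; exact: measurable_bigcap_seq.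
Qed.

Lemma indep_after_set0 n : indep_after n set0 0.
Proof. by apply: indep_after_null; rewrite ?measure0. Qed.

Lemma indep_afterU n A A' c c' : A `&` A' = set0 ->
  indep_after n A c -> indep_after n A' c' -> indep_after n (A `|` A') (c + c').
Proof.
move=> dA [mA H] [mA' H']; split; first exact: measurableU.
move=> s B us sn mB; rewrite setIUl; set E := \bigcap_(k in _) _.
have mE : measurable E by exact: measurable_bigcap_seq.
have -> : P ((A `&` E) `|` (A' `&` E)) = (P (A `&` E) + P (A' `&` E))%E.
  by apply: measureU; [exact: measurableI | exact: measurableI |
    rewrite setIACA dA set0I].
rewrite (H s B us sn mB) (H' s B us sn mB) EFinD muleDl//.
(* Distributivity in the extended reals leaves the finiteness of the product to be shown. *)
elim: s {us sn E mE} mB => [|k s IHs] mB; first by rewrite big_nil.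
rewrite big_cons fin_numM//; last first.
  by apply: IHs => i si; apply: mB; rewrite inE si orbT.
rewrite fin_num_measure//; apply: measurable_preimage_RV.
by apply: mB; rewrite mem_head.
Qed.

(** [Z k] may take any real value, but the masses at 0 and 1 already add up to 1. *)
Lemma prob_Z_notin01 k : (0 < k)%N ->
  P (Z k @^-1` (~` [set 0; 1])) = 0%E.
Proof.
move=> k0; have [P1 P0] := proj2 hZ k k0.
have -> : Z k @^-1` (~` [set 0; 1]) =
    ~` (Z k @^-1` [set 0] `|` Z k @^-1` [set 1]).
  by [].
have m01 (r : R) : measurable (Z k @^-1` [set r]).
  exact: measurable_preimage_RV (measurable_set1 r).
rewrite probability_setC; last exact: measurableU.
have -> : P (Z k @^-1` [set 0] `|` Z k @^-1` [set 1]) = 1%E.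
  transitivity (P (Z k @^-1` [set 0%R]) + P (Z k @^-1` [set 1%R]))%E.
    apply: measureU => //; apply/seteqP; split=> // w [/= ->] /eqP.
    by rewrite eq_sym oner_eq0.
  by rewrite P0 P1 -EFinD subrK.
exact: subee.
Qed.

Lemma measurable_dickman_sum n (x : R) :
  measurable [set v | dickman_sum Z n v = x].
Proof.
rewrite -[X in measurable X]setTI.
have /(_ measurableT [set x] (measurable_set1 x)) // :
  measurable_fun setT (dickman_sum Z n).
apply: measurable_sum => k; exact: measurable_realfun.measurable_funM.
Qed.

Lemma dickman_sumS n w :
  dickman_sum Z n.+1 w = dickman_sum Z n w + n.+1%:R * Z n.+1 w.
Proof. by rewrite /dickman_sum big_nat_recr. Qed.

Let indep_after_dickman_sum_nn n A c (i j : int) :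
  indep_after n A c -> A `<=` [set v | dickman_sum Z n v = i%:~R] ->
  indep_after n (A `&` [set v | dickman_sum Z n v = (i + j)%:~R])
    (c * coefz (dickman_poly R n n) j).
Proof.
move=> hA An; rewrite dickman_polynn; have [->|j0] := eqVneq j 0.
  by rewrite addr0 (setIidl An) /= coef1 mulr1.
have -> : A `&` [set v | dickman_sum Z n v = (i + j)%:~R] = set0.
  apply/seteqP; split=> // w [/An /= ->] /eqP.
  by rewrite eqr_int -subr_eq0 opprD addNKr oppr_eq0 (negPf j0).
have -> : coefz 1 j = 0 :> R.
  by move: j0; case: j => // -[|k]//= _; rewrite coef1.
by rewrite mulr0; exact: indep_after_set0.
Qed.

(** Induction on n, splitting on the value of Z_(n+1) as the coefficient recursion does. A general
    [A] covers both the law of T_n, from the whole space, and its joint law with T_m, from the event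
    T_m = i. *)
Lemma indep_after_dickman_sum m n A c (i j : int) : (m <= n)%N ->
  indep_after m A c -> A `<=` [set v | dickman_sum Z m v = i%:~R] ->
  indep_after n (A `&` [set v | dickman_sum Z n v = (i + j)%:~R])
    (c * coefz (dickman_poly R m n) j).
Proof.
move=> + hA Am; elim: n j => [|n IHn] j.
  rewrite leqn0 => /eqP m0; rewrite m0 in hA Am *.
  exact: indep_after_dickman_sum_nn.
rewrite leq_eqVlt => /predU1P[<-|mn]; first exact: indep_after_dickman_sum_nn.
have {}IHn := IHn _ mn.
have [P1 P0] := proj2 hZ n.+1 isT.
rewrite dickman_polyS// coefz_bernoulli_polyM//.
set E := fun n j => [set v | dickman_sum Z n v = (i + j)%:~R].
(* The third piece is null and accounts for the values other than 0 and 1. *)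
have -> : A `&` E n.+1 j = A `&` E n (j - n.+1%:Z) `&` Z n.+1 @^-1` [set 1]
  `|` A `&` E n j `&` Z n.+1 @^-1` [set 0]
  `|` A `&` E n.+1 j `&` Z n.+1 @^-1` (~` [set 0; 1]).
  have shift : (i + (j - n.+1%:Z))%:~R = (i + j)%:~R - n.+1%:R :> R.
    by rewrite addrA intrB.
  apply/seteqP; split=> w; rewrite /E /= dickman_sumS shift.
    move=> [Aw Tw]; have [Z1|Z1] := eqVneq (Z n.+1 w) 1.
      by do 2 left; rewrite Z1 mulr1 in Tw; rewrite -Tw addrK.
    have [Z0|Z0] := eqVneq (Z n.+1 w) 0.
      by left; right; rewrite Z0 mulr0 addr0 in Tw.
    by right; split=> // -[] /eqP; apply/negP.
  move=> [[[[Aw Tw] Zw]|[[Aw Tw] Zw]]|[[Aw Tw] _]]; split=> //.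
    by rewrite Tw Zw mulr1 subrK.
  by rewrite Tw Zw mulr0 addr0.
set p := dickman_poly R m n.
have -> : c * ((1 - n.+1%:R^-1) * coefz p j +
               n.+1%:R^-1 * coefz p (j - n.+1%:Z)) =
    c * coefz p (j - n.+1%:Z) * (1 / n.+1%:R) +
    c * coefz p j * (1 - 1 / n.+1%:R)
    + 0 by ring.
have m01 : measurable (~` [set 0; 1] : set R).
  apply: measurableC.
  exact: measurableU (measurable_set1 _) (measurable_set1 _).
apply: indep_afterU; last first.
- apply: indep_after_null.
    apply: measurableI; last exact: measurable_preimage_RV.
    exact: measurableI hA.1 (measurable_dickman_sum _ _).
  apply: subset_measure0 (prob_Z_notin01 (ltn0Sn n)) => //.
  + apply: measurableI; last exact: measurable_preimage_RV.
    exact: measurableI hA.1 (measurable_dickman_sum _ _).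
  + exact: measurable_preimage_RV.
- apply: indep_afterU; [
    | exact: indep_after_cond (IHn _) (measurable_set1 _) P1
    | exact: indep_after_cond (IHn _) (measurable_set1 _) P0].
  apply/seteqP; split=> // w [[_ /= Z1] [_ /= Z0]].
  by move: Z1; rewrite Z0 => /eqP; rewrite eq_sym oner_eq0.
- apply/seteqP; split=> // w [[[_ /= Z1]|[_ /= Z0]] [_ /= nZ]]; apply: nZ.
    by right.
  by left.
Qed.

Definition dickman_law (m n : nat) (j : int) : R :=
  coefz (dickman_poly R m n) j.

Lemma prob_dickman_sum n (i : int) :
  P [set v | dickman_sum Z n v = i%:~R] = (dickman_law 0 n i)%:E.
Proof.
have := indep_after_dickman_sum i (leq0n n) indep_after_setT (i := 0).
rewrite setTI add0r mul1r => H; apply: (indep_after_prob (n := n)); apply: H.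
by move=> w _; rewrite /= /dickman_sum big_geq.
Qed.

Lemma prob_dickman_sumI m n (i j : int) : (m <= n)%N ->
  P ([set v | dickman_sum Z m v = i%:~R] `&`
     [set v | dickman_sum Z n v = j%:~R]) =
  (dickman_law 0 m i * dickman_law m n (j - i))%:E.
Proof.
move=> mn; rewrite -[j in LHS](subrKC i).
apply: (indep_after_prob (n := n)); apply: indep_after_dickman_sum => //.
have := indep_after_dickman_sum i (leq0n m) indep_after_setT (i := 0).
rewrite setTI add0r mul1r; apply.
by move=> w _; rewrite /= /dickman_sum big_geq.
Qed.

(** Bilinearity pulls out m n, and the joint probability and the product of the marginals share the
    factor P(T_m = kappa_m). *)
Lemma covariance_Yvar (kappa : nat -> int) m n : (m <= n)%N ->
  covariance P (Yvar Z kappa m) (Yvar Z kappa n) =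
  (m%:R * n%:R * dickman_law 0 m (kappa m) *
   (dickman_law m n (kappa n - kappa m) - dickman_law 0 n (kappa n)))%:E.
Proof.
move=> mn.
pose E k := [set v | dickman_sum Z k v = (kappa k)%:~R].
have mE k : measurable (E k) by exact: measurable_dickman_sum.
have L1 (A : set T) : measurable A -> (\1_A : T -> R) \in Lfun P 1.
  by move=> mA; apply/Lfun1_integrable; exact: integrable_indic.
have YE k : Yvar Z kappa k = k%:R \o* (\1_(E k) : T -> R).
  by apply/funext => w; rewrite /Yvar /= mulrC.
have EI : ((\1_(E m) : T -> R) * \1_(E n) = \1_(E m `&` E n))%R.
  by rewrite indicI.
have LI : ((\1_(E m) : T -> R) * \1_(E n))%R \in Lfun P 1.
  by rewrite EI; apply: L1; exact: measurableI.
rewrite !YE covarianceZl ?L1 ?Lfun_scale ?L1//; last first.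
  rewrite (_ : (_ * _)%R = n%:R \o* ((\1_(E m) : T -> R) * \1_(E n))%R).
    exact: Lfun_scale.
  by apply/funext => w; rewrite /= mulrA.
rewrite covarianceZr ?L1// covarianceE ?L1//.
rewrite EI !expectation_indic//; last exact: measurableI.
rewrite prob_dickman_sumI// !prob_dickman_sum.
set a := dickman_law 0 m _; set b := dickman_law m n _.
set c := dickman_law 0 n _.
transitivity (m%:R * (n%:R * (a * b - a * c)))%:E; first by [].
by congr EFin; ring.
Qed.

End Law.

(** * Logarithmic estimates and lower bounds for [chi] *)

(** Passing from n to n + 1 adds -log(1 - 1/(n+1)) >= 1/(n+1) on the right. *)
Lemma harmonic_sum_le_ln (R : realType) (m n : nat) : (0 < m)%N -> (m <= n)%N ->
  harmonic_sum R m n <= ln (n%:R / m%:R).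
Proof.
move=> m0; have m0R : 0 < m%:R :> R by rewrite ltr0n.
elim: n => [|n IHn]; first by rewrite leqn0 => /eqP mE; rewrite mE in m0.
rewrite leq_eqVlt => /predU1P[<-|mn].
  by rewrite divff ?gt_eqF// ln1 /harmonic_sum big_geq.
have n0 : 0 < n%:R :> R by rewrite ltr0n (leq_trans m0).
have n1 : 0 < n.+1%:R :> R by [].
rewrite /harmonic_sum big_nat_recr//= -/(harmonic_sum R m n).
have -> : n.+1%:R / m%:R = (n%:R / m%:R) / (1 + - n.+1%:R^-1) :> R.
  rewrite -natr1; field.
  by rewrite natr1 (gt_eqF m0R) (gt_eqF n1) -natr1 addrK (gt_eqF n0).
have v1 : 0 < 1 + - n.+1%:R^-1 :> R.
  by rewrite subr_gt0 invf_lt1// ltr1n ltnS (leq_trans m0).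
rewrite ln_div ?posrE ?divr_gt0//.
have := @le_ln1Dx R (- n.+1%:R^-1); rewrite ltrN2 invf_lt1// ltr1n ltnS.
move=> /(_ (leq_trans m0 mn)); have := IHn mn.
by set v := n.+1%:R^-1; set l := ln (1 - v); lra.
Qed.

Lemma ln_ratio_gt0 (R : realType) (m n : nat) : (0 < m)%N -> (m < n)%N ->
  0 < ln (n%:R / m%:R) :> R.
Proof.
by move=> m0 mn; rewrite ln_gt0// ltr_pdivlMr ?ltr0n// mul1r ltr_nat.
Qed.

Lemma gfun_ge0 (R : realType) (C0 : R) (m n : nat) : 0 <= C0 ->
  (0 < m)%N -> (m < n)%N -> 0 <= gfun C0 m n.
Proof.
move=> C00 m0 mn; have L0 := ln_ratio_gt0 R m0 mn.
have N0 : 0 < n%:R - m%:R :> R by rewrite subr_gt0 ltr_nat.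
rewrite /gfun addr_ge0 ?divr_ge0 ?(ltW L0)// subr_ge0 -[leLHS]expR0 ler_expR.
rewrite mulr_ge0 ?sqr_ge0// mulr_ge0// addr_ge0//.
  by rewrite divr_ge0 ?sqr_ge0 ?(ltW L0).
by rewrite divr_ge0 ?(ltW N0)// addr_ge0.
Qed.

(** The [gfun] term and the last term of [chi] are nonnegative when kappa_m < kappa_n. *)
Lemma chi_ge (R : realType) (C0 x : R) (kappa : nat -> int) (m n : nat) :
  0 <= C0 -> (0 < m)%N -> (m < n)%N -> kappa m < kappa n ->
  (n%:R - m%:R) / ((kappa n)%:~R - (kappa m)%:~R)
    * (ln (n%:R / m%:R) / Num.sqrt (n%:R - m%:R))
  + x * `|(n%:R - m%:R) / ((kappa n)%:~R - (kappa m)%:~R) - 1 / x|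
  <= chi C0 kappa x m n.
Proof.
move=> C00 m0 mn kmn; have g0 := gfun_ge0 C00 m0 mn.
have N0 : 0 < n%:R - m%:R :> R by rewrite subr_gt0 ltr_nat.
have D0 : 0 < (kappa n)%:~R - (kappa m)%:~R :> R by rewrite subr_gt0 ltr_int.
rewrite /chi.
have := mulr_ge0 (divr_ge0 (ltW N0) (ltW D0)) g0.
have : 0 <= (m%:R + 1) / ((kappa n)%:~R - (kappa m)%:~R) :> R.
  by rewrite divr_ge0 ?(ltW D0)// addr_ge0.
lra.
Qed.

Lemma chi_ge0 (R : realType) (C0 x : R) (kappa : nat -> int) (m n : nat) :
  0 <= C0 -> 0 <= x -> (0 < m)%N -> (m < n)%N -> kappa m < kappa n ->
  0 <= chi C0 kappa x m n.
Proof.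
move=> C00 x0 m0 mn kmn; apply: le_trans (chi_ge x C00 m0 mn kmn).
have N0 : 0 <= n%:R - m%:R :> R by rewrite subr_ge0 ler_nat ltnW.
have D0 : 0 <= (kappa n)%:~R - (kappa m)%:~R :> R.
  by rewrite subr_ge0 ler_int ltW.
have L0 := ltW (ln_ratio_gt0 R m0 mn).
by rewrite addr_ge0 ?mulr_ge0 ?invr_ge0 ?sqrtr_ge0.
Qed.

(** With N = n - m the right side is the left side times n / sqrt N, and sqrt N <= N <= n because N
    >= 1. *)
Lemma log_term_le (R : realType) (m n a : nat) : (0 < m)%N -> (m < n)%N ->
  (0 < a)%N ->
  ln (n%:R / m%:R) / a%:R <= n%:R / (n%:R - m%:R) * ((n%:R - m%:R) / a%:R
    * (ln (n%:R / m%:R) / Num.sqrt (n%:R - m%:R))) :> R.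
Proof.
move=> m0 mn a0; have L0 := ln_ratio_gt0 R m0 mn.
have a0R : 0 < a%:R :> R by rewrite ltr0n.
have N1 : 1 <= n%:R - m%:R :> R.
  by rewrite -natrB ?(ltnW mn)// ler1n subn_gt0.
set N : R := n%:R - m%:R in N1 *; set L := ln _ in L0 *.
have N0 : 0 < N by exact: lt_le_trans N1.
have sN0 : 0 < Num.sqrt N by rewrite sqrtr_gt0.
have sNn : Num.sqrt N <= n%:R.
  have : N <= n%:R by rewrite gerBl.
  apply: le_trans; rewrite -[leRHS]sqr_sqrtr ?(ltW N0)// expr2 ler_peMl//.
  by rewrite -[leLHS]sqrtr1 ler_wsqrtr.
have -> : n%:R / N * (N / a%:R * (L / Num.sqrt N)) =
    L / a%:R * (n%:R / Num.sqrt N).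
  by field; rewrite (gt_eqF N0) (gt_eqF sN0) (gt_eqF a0R).
by rewrite ler_peMr ?divr_ge0 ?(ltW L0)// ler_pdivlMr// mul1r.
Qed.

(** The hypothesis gives x N / a < 3/2, so 1/a is at most 3/(2 x N). *)
Lemma ratio_le (R : realFieldType) (x m N a : R) : 0 < x -> 0 <= m -> 0 < N ->
  0 < a -> x * `|N / a - 1 / x| < 2^-1 -> m / a <= 3 / (2 * x) * (m / N).
Proof.
move=> x0 m0 N0 a0.
rewrite -[X in X * _](ger0_norm (ltW x0)) -normrM mulrBr mul1r mulfV ?gt_eqF//.
rewrite ltr_norml => /andP[_ u2].
have Na : x * N <= 3 / 2 * a by rewrite -ler_pdivrMr//; lra.
have -> : 3 / (2 * x) * (m / N) = m * (3 / 2 / (x * N)).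
  by field; rewrite (gt_eqF N0) (gt_eqF x0).
rewrite ler_wpM2l// ler_pdivlMr ?mulr_gt0// mulrC ler_pdivrMr//.
Qed.

Lemma normr_sub_le2 (R : realDomainType) (c b b' : R) :
  0 <= c <= 2 -> 0 <= b <= 2 -> 0 <= b' <= 2 -> `|c * (b - b')| <= 4.
Proof.
move=> /andP[c0 c2] bE bE'; rewrite normrM (ger0_norm c0).
rewrite (_ : 4 = 2 * 2); last by ring.
by rewrite ler_pM// ler_norml; lra.
Qed.

(** * Assembly of the covariance bound *)

Unset Implicit Arguments.

Theorem theorem5p1 (R : realType) :
  exists C0 : R, 0 < C0 /\
  forall x : R, 0 < x ->
  exists C : R, 0 < C /\
  forall (d : measure_display) (T : measurableType d) (P : probability T R)
    (Z : nat -> {RV P >-> R}) (kappa : nat -> int),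
  harmonic_bernoulli Z ->
  (fun n : nat => (kappa n)%:~R / n%:R : R) @ \oo --> x ->
  forall m n : nat, (2 <= m)%N -> (m < n)%N ->
  (kappa m < kappa n)%R -> (kappa 2%N < kappa n)%R ->
  (`| covariance P (Yvar Z kappa m) (Yvar Z kappa n) | <=
   (C * (n%:R / (n%:R - m%:R) * chi C0 kappa x m n
         + m%:R / (n%:R - m%:R)
         + chi C0 kappa x 2 n
         + 1 / n%:R))%:E)%E.
Proof.
(* 40 dominates the coefficient 32 of the harmonic sum, and half of it exceeds the trivial bound 4;
   102/x is 68 times the factor 3/(2x) of [ratio_le]. *)
exists 1; split=> // x x0; exists (40 + 102 / x).
have x102 : 0 < 102 / x by rewrite divr_gt0.
have C0 : 0 < 40 + 102 / x by rewrite addr_gt0.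
split=> // d T P Z kappa hZ _ m n m2 mn kmn k2n.
have m0 : (0 < m)%N by exact: leq_trans m2.
rewrite covariance_Yvar ?(ltnW mn)// abse_EFin lee_fin.
have m0R : 0 < m%:R :> R by rewrite ltr0n.
have n0R : 0 < n%:R :> R by rewrite ltr0n (ltn_trans m0 mn).
have N0 : 0 < n%:R - m%:R :> R by rewrite subr_gt0 ltr_nat.
have chi2 : 0 <= chi 1 kappa x 2 n.
  by apply: chi_ge0 => //; [exact: ltW | exact: leq_trans mn].
have chim : 0 <= chi 1 kappa x m n by apply: chi_ge0 => //; exact: ltW.
set A := n%:R / (n%:R - m%:R) * _; set B := m%:R / _.
have A0 : 0 <= A by rewrite mulr_ge0// divr_ge0 ?(ltW N0).
have B0 : 0 <= B by rewrite divr_ge0 ?(ltW N0).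
apply: (@le_trans _ _ ((40 + 102 / x) * (A + B))); last first.
  by rewrite ler_wpM2l ?(ltW C0)// -addrA lerDl addr_ge0// divr_ge0.
(* T_m is almost surely nonnegative, so a negative kappa_m makes the covariance 0. *)
have [km0|km0] := ltP (kappa m) 0.
  have -> : dickman_law R 0 m (kappa m) = 0 by case: (kappa m) km0.
  by rewrite mulr0 mul0r normr0 mulr_ge0 ?addr_ge0// ltW.
have [i kmE] : exists i : nat, kappa m = i.
  by exists `|kappa m|%N; rewrite gez0_abs.
have [a a0 knE] : exists2 a : nat, (0 < a)%N & kappa n = (i + a)%N.
  by exists `|kappa n - kappa m|%N; lia.
have a0R : 0 < a%:R :> R by rewrite ltr0n.
have akE : kappa n - kappa m = a by rewrite kmE knE PoszD addrAC subrr add0r.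
have := chi_ge x (ler01 : 0 <= 1 :> R) m0 mn kmn.
rewrite -intrB akE knE kmE /dickman_law /=.
set q := (dickman_poly R 0 m)`_i; set p := (dickman_poly R m n)`_a.
set f := (dickman_poly R 0 n)`_(i + a).
have q0 : 0 <= q by exact: dickman_poly_nneg.
have nN : 1 <= n%:R / (n%:R - m%:R) :> R by rewrite ler_pdivlMr// mul1r gerBl.
have := log_term_le R m0 mn a0.
have := @ratio_le R x m%:R (n%:R - m%:R) a%:R x0 (ltW m0R) N0 a0R.
set u := x * `|_|; set t := _ * (_ / Num.sqrt _) => ma_le La_le chi_m.
have u0 : 0 <= u by rewrite mulr_ge0// ltW.
(* As n/(n - m) >= 1, the deviation [u] survives in full inside [A]. *)
have ut : n%:R / (n%:R - m%:R) * t + u <= A.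
  apply: le_trans (ler_wpM2l (le_trans ler01 nN) chi_m).
  by rewrite mulrDr lerD2l ler_peMl.
have t0 : 0 <= n%:R / (n%:R - m%:R) * t.
  by apply: le_trans La_le; rewrite divr_ge0// ltW// ln_ratio_gt0.
(* If u >= 1/2 then A >= 1/2, and the bounds 2 on m q, n p and n f suffice. Otherwise m/a is
   controlled by [B] and the decorrelation estimate applies. *)
have [u2|/ma_le {}ma_le] := leP 2^-1 u.
  apply: (@le_trans _ _ 4).
    have -> : m%:R * n%:R * q * (p - f) = (m%:R * q) * (n%:R * p - n%:R * f).
      by ring.
    apply: normr_sub_le2; rewrite mulr_ge0 ?dickman_poly_nneg//=.
    - exact: coef_dickman_poly0_le.
    - by rewrite coef_dickman_poly_le// ltnW.
    - by rewrite coef_dickman_poly0_le// (ltn_trans m0 mn).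
  have AB2 : 2^-1 <= A + B.
    by rewrite (le_trans u2)// ler_wpDr// (le_trans _ ut)// lerDr.
  have := ler_wpM2l (ltW C0) AB2; apply: le_trans.
  by move: x102; move: (102 / x) => y; lra.
have -> : `|m%:R * n%:R * q * (p - f)| = m%:R * n%:R * q * `|p - f|.
  by rewrite normrM ger0_norm// !mulr_ge0.
apply: (le_trans (coef_dickman_poly_decorrelation R i m0 (ltnW mn) a0)).
have HA : harmonic_sum R m n / a%:R <= A.
  apply: (@le_trans _ _ (ln (n%:R / m%:R) / a%:R)).
    by rewrite ler_wpM2r ?invr_ge0// harmonic_sum_le_ln// ltnW.
  by rewrite (le_trans La_le)// (le_trans _ ut)// lerDl.
rewrite mulrDl -!mulrA.
have mB : 68 * (m%:R / a%:R) <= 102 / x * B.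
  rewrite (_ : 102 / x * B = 68 * (3 / (2 * x) * B)).
    by rewrite ler_wpM2l.
  by field; rewrite gt_eqF.
have yA : 0 <= 102 / x * A by rewrite mulr_ge0// ltW.
clear -HA mB yA A0 B0.
move: (harmonic_sum R m n / a%:R) (m%:R / a%:R) HA mB yA => h r.
move: (102 / x) => y; move: A B A0 B0 => A B; lra.
Qed.
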